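(* Let $N\ge1$ and let $n_1<\cdots<n_N$ be positive integers. There exists an mB-spline $\boldsymbol{\eta}=(\eta_1,\ldots,\eta_N)\in(L_2(\mathbb{R}))^N$ of $S_{n_1}+\cdots+S_{n_N}$ that can be constructed recursively with increment and insertion steps, i.e., that can be obtained by applying a finite sequence of increment steps and insertion steps to a collection consisting of a single B-spline $(\beta_+^{m})$ for some integer $m\ge0$.
   Context: Splines. For an integer $n\ge0$, $S_n$ is the space of cardinal splines of degree $n$: functions $f:\mathbb{R}\to\mathbb{R}$ that on each $[k,k+1)$, $k\in\mathbb{Z}$, coincide with a polynomial of degree at most $n$ and, if $n\ge1$, have continuous derivatives up to order $n-1$ on $\mathbb{R}$. $\beta_+^0=\mathbf{1}_{[0,1)}$ and $\beta_+^{n+1}=\beta_+^n*\beta_+^0$ is the causal B-spline of degree $n+1$. For $\mathbf{n}=(n_1,\ldots,n_N)$ with $0\le n_1<\cdots<n_N$, the multi-spline space is $S_{\mathbf{n}}=S_{n_1}+\cdots+S_{n_N}$. Support size. $|f|$ is the Lebesgue measure of $\mathrm{supp}(f)=\overline{\{x:f(x)\neq0\}}$ for compactly supported $f$, and $|\boldsymbol{\phi}|=\sum_n|\phi_n|$ for a finite collection. mB-spline. A finite collection $\boldsymbol{\phi}=(\phi_1,\dots,\phi_K)$ of compactly supported functions in $S_{\mathbf{n}}$ is an mB-spline of $S_{\mathbf{n}}$ (i.e. a shortest-support basis of $S_{\mathbf{n}}$) if it generates $S_{\mathbf{n}}$, meaning that every $f\in S_{\mathbf{n}}$ (in particular each B-spline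 $\beta_+^{n_s}$, $s=1,\ldots,N$) can be written as $f(x)=\sum_{k\in\mathbb{Z}}\sum_{i=1}^{K} c_i[k]\phi_i(x-k)$ for all $x$ with some real sequences $c_i$ (not necessarily in $\ell_2$), and $|\boldsymbol{\phi}|=n_N+1$. Standardization. A collection $(\phi_1,\ldots,\phi_K)$ of compactly supported functions is standardized if for each $i$: $\int_{\mathbb{R}}\phi_i(t)\,dt\in\{0,1\}$ and $\inf\{t:\phi_i(t)\ne0\}\in[0,1)$. Any collection of nonzero compactly supported functions may be standardized by integer translations and nonzero rescalings of its components; collections are standardized in this way before each step below. Increment step. Let $\boldsymbol{\eta}=(\eta_1,\ldots,\eta_K)$ be standardized, let $H_s(x)=\int_{-\infty}^x\eta_s(t)\,dt$, let $\Delta f(x)=f(x)-f(x-1)$, and let $s_0$ be the index of a component of smallest support size among those with $\int_{\mathbb{R}}\eta_{s}(t)\,dt\ne0$. The increment step outputs $\boldsymbol{\theta}=(\theta_1,\ldots,\theta_K)$ with $\theta_{s_0}=\Delta H_{s_0}$ and, for $s\neq s_0$, $\theta_s=H_s$ if $\int_{\mathbb{R}}\eta_s(t)\,dt=0$ and $\theta_s=H_s-H_{s_0}$ if $\int_{\mathbb{R}}\eta_s(t)\,dt\neq0$. Insertion step. Let $\boldsymbol{\eta}=(\eta_1,\ldots,\eta_K)$ be standardized. The insertion step is the increment step applied to $(\delta,\eta_1,\ldots,\eta_K)$, where $\delta$ is the Dirac distribution (playing the role of the shortest component). Explicitly, it outputs $(\theta_0',\theta_1',\ldots,\theta_K')$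 with $\theta_0'=\beta_+^0$ and, for $i\ge1$, $\theta_i'(x)=\int_{-\infty}^x\eta_i(t)\,dt$ if $\int_{\mathbb{R}}\eta_i(t)\,dt=0$ and $\theta_i'(x)=\int_{-\infty}^x\eta_i(t)\,dt-\mathbf{1}_{[0,\infty)}(x)$ if $\int_{\mathbb{R}}\eta_i(t)\,dt\ne0$. *)

(* Defs.v *)
From mathcomp Require Import all_boot all_order all_algebra.
From mathcomp Require Import all_classical all_reals all_analysis.

Set Implicit Arguments.
Unset Strict Implicit.
Unset Printing Implicit Defensive.
Import Order.TTheory GRing.Theory Num.Theory.
Import numFieldNormedType.Exports.

Local Open Scope classical_set_scope.
Local Open Scope ring_scope.

Section Splines.
Context {R : realType}.
Local Notation mu := (@lebesgue_measure R).
Implicit Types (f g : R -> R).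

(* [size p <= n.+1] means that p has degree at most n.  The last two clauses
   say that f is of class C^(n-1) when n >= 1; both are void when n = 0. *)
Definition cardinal_spline (n : nat) f : Prop :=
  [/\ forall k : int, exists2 p : {poly R}, (size p <= n.+1)%N &
        forall x, k%:~R <= x < (k + 1)%:~R -> f x = p.[x],
      forall j : nat, (j.+1 < n)%N -> forall x, derivable (f^`(j))%classic x 1
    & forall j : nat, (j < n)%N -> continuous (f^`(j))%classic].

Definition multi_spline (N : nat) (n : 'I_N -> nat) f : Prop :=
  exists2 g : 'I_N -> R -> R, forall s, cardinal_spline (n s) (g s) &
    forall x, f x = \sum_(s < N) g s x.

Definition convolution f g : R -> R :=
  fun x => \int[mu]_t (f t * g (x - t)).

Definition box : R -> R := \1_`[0, 1[.

Fixpoint bspline (n : nat) : R -> R :=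
  if n is m.+1 then convolution (bspline m) box else box.

Definition supp f : set R := closure [set x | f x != 0].

Definition compactly_supported f : Prop := compact (supp f).

Definition supp_size f : \bar R := mu (supp f).

(* The sum over k is taken over the (finite, because the functions phi i are
   compactly supported wherever this is used) set of nonzero terms. *)
Definition generates (N : nat) (n : 'I_N -> nat)
    (K : nat) (phi : 'I_K -> R -> R) : Prop :=
  forall f, multi_spline n f -> exists c : 'I_K -> int -> R,
    forall x, f x =
      \sum_(k \in [set: int]) \sum_(i < K) c i k * phi i (x - k%:~R).

(* For increasing degrees n, [n ord_max] is the largest one. *)
Definition mB_spline (N : nat) (n : 'I_N.+1 -> nat)
    (K : nat) (phi : 'I_K -> R -> R) : Prop :=
  [/\ forall i, compactly_supported (phi i),
      forall i, multi_spline n (phi i),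
      generates n phi
    & (\sum_(i < K) supp_size (phi i) = (n ord_max).+1%:R%:E)%E].

(* The infimum is taken in the extended reals, so that it is +oo for the zero
   function, which is therefore not standardized. *)
Definition standardized (K : nat) (eta : 'I_K -> R -> R) : Prop :=
  forall i, [/\ compactly_supported (eta i),
    \int[mu]_t eta i t = 0 \/ \int[mu]_t eta i t = 1
  & (0 <= ereal_inf (EFin @` [set t | eta i t != 0%R]) < 1)%E].

Definition standardization (K : nat) (phi eta : 'I_K -> R -> R) : Prop :=
  standardized eta /\
  forall i, exists2 a : R, a != 0 &
    exists m : int, forall x, eta i x = a * phi i (x - m%:~R).

Definition primitive f : R -> R := fun x => \int[mu]_(t in `]-oo, x]) f t.

Definition backward_difference f : R -> R := fun x => f x - f (x - 1).

Definition shortest_nonzero_mean (K : nat) (eta : 'I_K -> R -> R)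
    (s0 : 'I_K) : Prop :=
  \int[mu]_t eta s0 t != 0 /\
  forall s, \int[mu]_t eta s t != 0 ->
    (supp_size (eta s0) <= supp_size (eta s))%E.

Definition increment (K : nat) (eta : 'I_K -> R -> R) (s0 : 'I_K) :
    'I_K -> R -> R :=
  fun s => if s == s0 then backward_difference (primitive (eta s0))
    else if \int[mu]_t eta s t == 0 then primitive (eta s)
    else primitive (eta s) \- primitive (eta s0).

(* The new component has index [ord0], the one coming from [eta i] has index
   [lift ord0 i]. *)
Definition insertion (K : nat) (eta : 'I_K -> R -> R) : 'I_K.+1 -> R -> R :=
  fun s => if unlift ord0 s is Some i then
      if \int[mu]_t eta i t == 0 then primitive (eta i)
      else primitive (eta i) \- \1_`[0, +oo[
    else bspline 0.

(* Each step is applied to some standardization of the current collection;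
   ties for the shortest component may be broken arbitrarily. *)
Inductive constructible : forall K : nat, ('I_K -> R -> R) -> Prop :=
| constructible_bspline (m : nat) :
    constructible (fun _ : 'I_1 => bspline m)
| constructible_increment (K : nat) (phi eta : 'I_K -> R -> R) (s0 : 'I_K) :
    constructible phi -> standardization phi eta ->
    shortest_nonzero_mean eta s0 -> constructible (increment eta s0)
| constructible_insertion (K : nat) (phi eta : 'I_K -> R -> R) :
    constructible phi -> standardization phi eta ->
    constructible (insertion eta).

End Splines.

(* Main.v *)
Require Import Defs.
From mathcomp Require Import all_boot all_order all_algebra.
From mathcomp Require Import all_classical all_reals all_analysis.
From mathcomp Require Import measurable_realfun.
From mathcomp Require Import ring lra zify.
Import Order.TTheory GRing.Theory Num.Theory.
Import numFieldNormedType.Exports.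
Local Open Scope classical_set_scope.
Local Open Scope ring_scope.

Set Implicit Arguments.
Unset Strict Implicit.
Unset Printing Implicit Defensive.

(** All functions in the construction are given by their polynomial pieces: a
    map [Q : int -> {poly R}] stands for the function whose restriction to
    [k, k+1) is [Q k] read in the local coordinate [x - k].  In these terms the
    multi-spline space with degree set [D] and largest degree [d] is described
    locally ([mspline]): all pieces have degree at most [d], and passing an
    integer only adds multiples of the monomials of degree in [D].

    The collections met along the way satisfy the invariant [mBpieces]: the
    i-th function lives on the cells 0, ..., L_i - 1, the L_i add up to d + 1,
    the functions belong to the space and generate it, and one of them has a
    nonzero mean.

    The increment step preserves the invariant, raising all degrees by one
    ([incr_mBpieces]).  If Q lies in the raised space, then Q' lies in the
    original one and expands over the shifts of eta.  Since theta_s' is eta_s,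
    or eta_s - eta_s0, and theta_s0' is the backward difference of eta_s0,
    the same coefficients serve for theta_s, and those of theta_s0 solve a
    first-order difference equation over the integers.  The resulting
    combination differs from Q by a constant, because both are continuous, and
    constants are generated since the integer shifts of theta_s0 add up to 1.
    The insertion step adds the degree 0 ([ins_mBpieces]): there the
    difference is only piecewise constant, which is what the shifts of the box
    produce.

    Supports are known exactly, for reasons of dimension.  On a single cell, a
    generating collection spans the polynomials of degree at most d, a space of
    dimension d + 1, using only the pieces of its functions, of which there are
    d + 1.  Hence these pieces form a basis, none of them is zero
    ([mBpieces_neq0]), and the supports are the full intervals [0, L_i].  In
    particular the total support size is d + 1, and the shortest function in
    the sense of the Lebesgue measure is the one with the smallest L_i.

    Given the degrees, the construction is found backwards
    ([constructible_pieces]): lower all degrees by one, the last step being an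
    insertion if 0 was one of them and an increment otherwise, until only the
    degree 0 is left, which the box takes care of.  It remains to compare
    [mspline] with the analytic definition of cardinal splines: continuity of
    the derivatives at the integers gives the condition on the jumps
    ([cardinal_spline_pieces]), and conversely a compactly supported element
    is a finite sum of truncated powers ([multi_spline_realize]), where all
    degrees being positive ensures continuity. *)

(** * Piecewise polynomials on the integer grid *)

Section Pieces.
Variable R : realFieldType.
Implicit Types (p q : {poly R}) (P Q F : int -> {poly R}) (D : pred nat).

Lemma poly_deriv_eq0 p : p^`() = 0 -> p = (p`_0)%:P.
Proof.
move=> p'0; apply/polyP=> -[|i]; rewrite coefC//=.
have := congr1 (fun q => q`_i) p'0; rewrite coef_deriv coef0 => /eqP.
by rewrite mulrn_eq0 /= => /eqP.
Qed.

Lemma comp_poly_shift p (a b : R) :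
  (p \Po ('X + a%:P)) \Po ('X + b%:P) = p \Po ('X + (a + b)%:P).
Proof.
rewrite -comp_polyA comp_polyD comp_polyX comp_polyC -addrA -polyCD.
by rewrite [b + a]addrC.
Qed.

(** The antiderivative of [p] vanishing at 0.  The coefficient of index 0 is a
    division by 0, hence 0. *)
Definition antideriv p : {poly R} :=
  \poly_(i < (size p).+1) (p`_i.-1 / i%:R).

Lemma coef_antideriv p i : (antideriv p)`_i = p`_i.-1 / i%:R.
Proof.
rewrite coef_poly; case: ltnP => // hi.
by rewrite [p`__]nth_default ?mul0r//; case: i hi.
Qed.

Lemma deriv_antideriv p : (antideriv p)^`() = p.
Proof.
apply/polyP => i; rewrite coef_deriv coef_antideriv /= -[LHS]mulr_natr.
by rewrite divfK// pnatr_eq0.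
Qed.

Lemma antideriv0_horner p : (antideriv p).[0] = 0.
Proof. by rewrite horner_coef0 coef_antideriv invr0 mulr0. Qed.

Lemma antideriv0 : antideriv 0 = 0.
Proof. by apply/polyP => i; rewrite coef_antideriv !coef0 mul0r. Qed.

Lemma antiderivZ a p : antideriv (a *: p) = a *: antideriv p.
Proof. by apply/polyP => i; rewrite !(coef_antideriv, coefZ) mulrA. Qed.

(** The change of polynomial at the integer [k + 1], in the coordinate centred
    there. *)
Definition jump Q (k : int) : {poly R} := Q (k + 1) - (Q k \Po ('X + 1%:P)).

(** The pieces of the elements of the multi-spline space with degrees in [D];
    [d] stands for the largest degree. *)
Definition mspline D (d : nat) Q : Prop :=
  (forall k, (size (Q k) <= d.+1)%N) /\
  (forall k j, ~~ D j -> (jump Q k)`_j = 0).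

Lemma jumpE0 Q k : (jump Q k)`_0 = (Q (k + 1)).[0] - (Q k).[1].
Proof.
by rewrite /jump coefB -!horner_coef0 horner_comp !hornerE.
Qed.

Lemma jump_deriv Q k : (jump Q k)^`() = jump (fun k => (Q k)^`()) k.
Proof.
by rewrite /jump derivB deriv_comp derivD derivX derivC addr0 mulr1.
Qed.

Lemma msplineD D d P Q : mspline D d P -> mspline D d Q ->
  mspline D d (fun k => P k + Q k).
Proof.
move=> [sP jP] [sQ jQ]; split=> [k|k j Dj].
  by apply: leq_trans (size_polyD _ _) _; rewrite geq_max sP sQ.
have := jP k j Dj; have := jQ k j Dj; rewrite /jump comp_polyD !coefB !coefD.
lra.
Qed.

Lemma msplineZ D d a P : mspline D d P -> mspline D d (fun k => a *: P k).
Proof.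
move=> [sP jP]; split=> [k|k j Dj].
  exact: leq_trans (size_scale_leq _ _) (sP _).
have := jP k j Dj; rewrite /jump comp_polyZ !coefB !coefZ -mulrBr => ->.
by rewrite mulr0.
Qed.

Lemma msplineB D d P Q : mspline D d P -> mspline D d Q ->
  mspline D d (fun k => P k - Q k).
Proof.
move=> mP mQ; have [sz jp] := msplineD mP (msplineZ (-1) mQ).
split=> [k|k j Dj]; first by have := sz k; rewrite scaleN1r.
by have := jp k j Dj; rewrite /jump !scaleN1r.
Qed.

Lemma mspline0 D d : mspline D d (fun=> 0).
Proof.
by split=> [k|k j _]; rewrite ?size_poly0// /jump comp_poly0 subrr coef0.
Qed.

Lemma mspline_sum D d (I : finType) (P : I -> int -> {poly R}) :
  (forall i, mspline D d (P i)) -> mspline D d (fun k => \sum_i P i k).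
Proof.
move=> mP; elim: index_enum => [|i r IH].
  have [sz jp] := mspline0 D d.
  split=> [k|k j Dj]; first by rewrite big_nil; apply: (sz k).
  by rewrite /jump !big_nil; apply: (jp k j Dj).
have [sz jp] := msplineD (mP i) IH.
split=> [k|k j Dj]; first by rewrite big_cons; apply: (sz k).
by rewrite /jump !big_cons; apply: (jp k j Dj).
Qed.

Lemma mspline_translate D d P :
  mspline D d P -> mspline D d (fun k => P (k - 1)).
Proof.
move=> [sP jP]; split=> [k|k j Dj] //; have := jP (k - 1) j Dj.
by rewrite /jump addrAC.
Qed.

(** A polynomial, seen as a spline without jumps. *)
Lemma mspline_poly D d q : (size q <= d.+1)%N ->
  mspline D d (fun k => q \Po ('X + (k%:~R)%:P)).
Proof.
move=> sq; split=> [k|k j _].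
  by rewrite size_comp_poly2// size_XaddC.
by rewrite /jump comp_poly_shift intrD subrr coef0.
Qed.

(** The function vanishes outside [0, M). *)
Definition supported (M : nat) P : Prop :=
  forall k, ~~ (0 <= k < M%:Z) -> P k = 0.

(** The pieces of the combination of the integer shifts of [P] with coefficients
    [c].  The sum is finite because [P] is meant to be supported in [0, M). *)
Definition conv (M : nat) (c : int -> R) P (k : int) : {poly R} :=
  \sum_(j < M) c (k - j%:Z) *: P j%:Z.

Lemma conv_widen L M c P k : supported L P -> (L <= M)%N ->
  conv M c P k = conv L c P k.
Proof.
move=> sP LM; rewrite /conv.
rewrite [RHS](big_ord_widen M (fun j : nat => c (k - j%:Z) *: P j%:Z) LM).
rewrite [RHS]big_mkcond.
apply: eq_bigr => j _; case: ltnP => // Lj.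
by rewrite sP ?scaler0//; lia.
Qed.

(** The cell [j - 1] takes the place of the cell [j]; one more term is allowed so
    that both ends of the support are covered. *)
Lemma conv_step M c P k : supported M P ->
  conv M c P k = \sum_(j < M.+1) c (k + 1 - j%:Z) *: P (j%:Z - 1).
Proof.
move=> sP; rewrite big_ord_recl /= sP ?scaler0 ?add0r//.
by apply: eq_bigr => j _; congr (c _ *: P _); rewrite /= /bump /=; lia.
Qed.

Lemma conv_mspline D d M c P : supported M P -> mspline D d P ->
  mspline D d (conv M c P).
Proof.
move=> sP [szP jP]; split=> [k|k i Di].
  apply: leq_trans (size_sum _ _ _) _; apply/bigmax_leqP => j _.
  exact: leq_trans (size_scale_leq _ _) (szP _).
have -> : jump (conv M c P) k =
    \sum_(j < M.+1) c (k + 1 - j%:Z) *: jump P (j%:Z - 1).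
  rewrite /jump [conv M c P k]conv_step// -(conv_widen _ _ sP (leqnSn M)) /conv.
  rewrite raddf_sum. rewrite -sumrB; apply: eq_bigr => j _.
  by rewrite /= comp_polyZ -scalerBr subrK.
by rewrite coef_sum big1// => j _; rewrite coefZ jP// mulr0.
Qed.

Lemma convD M c c' P k :
  conv M (fun k => c k + c' k) P k = conv M c P k + conv M c' P k.
Proof. by rewrite -big_split; apply: eq_bigr => j _; rewrite scalerDl. Qed.

Lemma convB M c P P' k :
  conv M c (fun k => P k - P' k) k = conv M c P k - conv M c P' k.
Proof. by rewrite -sumrB; apply: eq_bigr => j _; rewrite scalerBr. Qed.

(** Summation by parts. *)
Lemma conv_diff M c P k : supported M P ->
  conv M.+1 c (fun k => P k - P (k - 1)) k =
  conv M.+1 (fun k => c k - c (k - 1)) P k.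
Proof.
move=> sP; rewrite convB.
have -> : conv M.+1 (fun k => c k - c (k - 1)) P k =
    conv M.+1 c P k - conv M.+1 (fun k => c (k - 1)) P k.
  by rewrite -sumrB; apply: eq_bigr => j _; rewrite scalerBl.
congr (_ - _); rewrite (conv_widen _ _ sP (leqnSn M)) (conv_step _ _ sP).
by apply: eq_bigr => j _; congr (c _ *: _); ring.
Qed.

Lemma conv_sumc M (I : finType) (A : pred I) (c : I -> int -> R) P k :
  conv M (fun k => \sum_(i | A i) c i k) P k = \sum_(i | A i) conv M (c i) P k.
Proof.
by rewrite exchange_big; apply: eq_bigr => j _; rewrite scaler_suml.
Qed.

Lemma deriv_conv M c P k :
  (conv M c P k)^`() = conv M c (fun k => (P k)^`()) k.
Proof.
by rewrite /conv raddf_sum; apply: eq_bigr => j _; rewrite /= derivZ.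
Qed.

(** The integral over [0, n]. *)
Definition cumul P (n : nat) : R := \sum_(i < n) (antideriv (P i%:Z)).[1].

(** The pieces of the primitive of a function vanishing on the negative
    half-line. *)
Definition prim P (k : int) : {poly R} :=
  if k is Posz n then (cumul P n)%:P + antideriv (P n) else 0.

(** The degree set [D + 1]. *)
Definition raise D : pred nat := fun j => if j is i.+1 then D i else false.

Lemma deriv_prim P k : (forall k, k < 0 -> P k = 0) -> (prim P k)^`() = P k.
Proof.
case: k => n P0 /=; last by rewrite deriv0 P0.
by rewrite derivD derivC add0r deriv_antideriv.
Qed.

Lemma prim_cont P k : (jump (prim P) k)`_0 = 0.
Proof.
rewrite jumpE0; case: k => [n|[|n]].
- rewrite -PoszD addn1 /= !hornerE antideriv0_horner /cumul big_ord_recr /=.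
  by rewrite addr0 subrr.
- by rewrite /= /cumul big_ord0 add0r antideriv0_horner horner0 subrr.
- have -> : Negz n.+1 + 1 = Negz n by lia.
  by rewrite /= !horner0 subrr.
Qed.

Lemma mspline_of_deriv D d Q : mspline D d (fun k => (Q k)^`()) ->
  (forall k, (jump Q k)`_0 = 0) -> mspline (raise D) d.+1 Q.
Proof.
have coefS p i : p`_i.+1 = p^`()`_i / i.+1%:R.
  by rewrite coef_deriv -[_ *+ _]mulr_natr mulfK// pnatr_eq0.
move=> [sQ jQ] Q0; split=> [k|k [|i]//= Di].
  apply/leq_sizeP => -[|j]// dj; rewrite coefS nth_default ?mul0r//.
  exact: leq_trans (sQ k) _.
by rewrite coefS jump_deriv jQ// mul0r.
Qed.

Lemma mspline_deriv D d Q : mspline D d.+1 Q ->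
  mspline (fun j => D j.+1) d (fun k => (Q k)^`()).
Proof.
move=> [sQ jQ]; split=> [k|k j Dj].
  apply/leq_sizeP => j dj; rewrite coef_deriv nth_default ?mul0rn//.
  exact: leq_trans (sQ k) _.
by rewrite -jump_deriv coef_deriv jQ ?mul0rn.
Qed.

Lemma prim_mspline D d P : (forall k, k < 0 -> P k = 0) ->
  mspline D d P -> mspline (raise D) d.+1 (prim P).
Proof.
move=> P0 mP; apply: mspline_of_deriv => [|k]; last exact: prim_cont.
by case: mP => sP jP; split=> *; rewrite /jump !deriv_prim//; apply: jP.
Qed.

(** Two continuous piecewise polynomials with the same derivative differ by a
    global constant. *)
Lemma pieces_of_deriv F Q : (forall k, (jump F k)`_0 = 0) ->
  (forall k, (jump Q k)`_0 = 0) -> (forall k, (F k)^`() = (Q k)^`()) ->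
  exists C, forall k, Q k = F k + C%:P.
Proof.
move=> F0 Q0 FQ; pose e k := (Q k - F k)`_0.
have eE k : Q k = F k + (e k)%:P.
  have <- : Q k - F k = (e k)%:P.
    by apply: poly_deriv_eq0; rewrite derivB FQ subrr.
  by rewrite addrC subrK.
have es k : e (k + 1) = e k.
  have := F0 k; have := Q0 k; rewrite !jumpE0 !eE !hornerE; lra.
exists (e 0) => k; rewrite eE; congr (_ + _%:P).
elim/int_rect: k => // n IH.
  by rewrite -IH -[RHS]es; congr e; lia.
by rewrite -[LHS]es -IH; congr e; lia.
Qed.

Lemma supported_lt0 M P k : supported M P -> k < 0 -> P k = 0.
Proof. by move=> sP k0; apply: sP; rewrite leNgt k0. Qed.

Lemma supportedW L M P : supported L P -> (L <= M)%N -> supported M P.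
Proof. move=> sP LM k hk; apply: sP; lia. Qed.

Lemma cumul_supported L M P : supported L P -> (L <= M)%N ->
  cumul P M = cumul P L.
Proof.
move=> sP LM; rewrite /cumul.
rewrite [RHS](big_ord_widen M (fun j => (antideriv (P j%:Z)).[1]) LM).
rewrite [RHS]big_mkcond.
apply: eq_bigr => j _; case: ltnP => // Lj; rewrite sP ?antideriv0 ?horner0//.
by lia.
Qed.

Lemma prim_tail L P (k : int) : supported L P -> L%:Z <= k ->
  prim P k = (cumul P L)%:P.
Proof.
move=> sP; case: k => [n|n] Ln; last by lia.
rewrite /= (cumul_supported sP)// [P n]sP ?antideriv0 ?addr0//; lia.
Qed.

Lemma prim_neg P k : k < 0 -> prim P k = 0.
Proof. by case: k. Qed.

(** The values of [d] are summed upwards from 0 on the positive side and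
    downwards on the negative side. *)
Lemma difference_eq (e : int -> R) : exists d, forall k, d k - d (k - 1) = e k.
Proof.
pose d (k : int) := match k with
  | Posz n => \sum_(i < n) e (i%:Z + 1)
  | Negz n => - \sum_(i < n.+1) e (- i%:Z) end.
exists d => -[[|n]|n].
- by rewrite sub0r /= big_ord0 big_ord1 opprK add0r oppr0.
- have -> : Posz n.+1 - 1 = n by lia.
  by rewrite /= big_ord_recr /= addrAC subrr add0r; congr e; lia.
- have -> : Negz n - 1 = Negz n.+1 by lia.
  rewrite /= [in X in _ - X]big_ord_recr /= opprK addrA addNr add0r.
  by congr e; lia.
Qed.

(** * The invariant, and the independence of the pieces *)

(** Every element of the space is a combination of integer shifts of the [P i].
    The bound [d.+1] in [conv] is large enough when the support lengths add up
    to [d.+1]. *)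
Definition generating D d K (P : 'I_K -> int -> {poly R}) : Prop :=
  forall Q, mspline D d Q -> exists c : 'I_K -> int -> R,
    forall k, Q k = \sum_i conv d.+1 (c i) (P i) k.

(** The invariant of the construction: the pieces of an mB-spline of the space
    with degrees in [D] and largest degree [d], the i-th function being
    supported in [0, L i]. *)
Record mBpieces D d K (P : 'I_K -> int -> {poly R}) (L : 'I_K -> nat) : Prop :=
  MBpieces {
    mBp_supp : forall i, supported (L i) (P i);
    mBp_pos : forall i, (0 < L i)%N;
    mBp_size : (\sum_i L i = d.+1)%N;
    mBp_spline : forall i, mspline D d (P i);
    mBp_gen : generating D d P;
    mBp_mean : exists i, cumul (P i) (L i) != 0 }.

Arguments mBp_supp {D d K P L} h i : rename.
Arguments mBp_mean {D d K P L} h : rename.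

Lemma mBp_le D d K (P : 'I_K -> int -> {poly R}) L i :
  mBpieces D d P L -> (L i <= d.+1)%N.
Proof. by move=> h; rewrite -(mBp_size h) (bigD1 i)//= leq_addr. Qed.

(** The [d.+1] pieces span the polynomials of degree at most [d] on one cell, so
    they are linearly independent. *)
Lemma mBpieces_neq0 D d K (P : 'I_K -> int -> {poly R}) L i j :
  mBpieces D d P L -> (j < L i)%N -> P i j%:Z != 0.
Proof.
move=> h jL; apply/eqP => Pij0.
(* The index set of the pieces, of cardinality [d.+1]. *)
pose T : finType := {i : 'I_K & 'I_(L i)}%type.
have cT : #|T| = d.+1.
  rewrite card_tagged sumnE big_map big_enum -(mBp_size h).
  by apply: eq_bigr => k _; rewrite card_ord.
pose ix (t : T) : nat := nat_of_ord (tagged t).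
pose pc (t : T) := P (tag t) (ix t)%:Z.
pose M := \matrix_(r < #|T|, l < d.+1) (pc (enum_val r))`_l.
have gen q : (size q <= d.+1)%N -> exists a : T -> R, q = \sum_t a t *: pc t.
  move=> /(mspline_poly D) /(mBp_gen h) [c cE].
  exists (fun t => c (tag t) (- (ix t)%:Z)).
  have := cE 0; rewrite addr0 comp_polyXr => ->.
  rewrite -[RHS](@sig_big_dep _ _ _ _ (fun i => 'I_(L i)) predT (fun=> predT)
    (fun i (j : 'I_(L i)) =>
       c i (- (nat_of_ord j)%:Z) *: P i (nat_of_ord j)%:Z)).
  apply: eq_bigr => k _; rewrite (conv_widen _ _ (mBp_supp h k) (mBp_le k h)).
  by apply: eq_bigr => l _; rewrite sub0r.
(* Writing the monomials in terms of the pieces gives a left inverse of the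
   square matrix [M] of their coefficients; its rows are thus free. *)
have [C CM] : exists C, C *m M = 1%:M.
  have /fin_all_exists[a aE] : forall l : 'I_d.+1,
      exists a : T -> R, 'X^l = \sum_t a t *: pc t.
    by move=> l; apply: gen; rewrite size_polyXn.
  exists (\matrix_(l, r) a l (enum_val r)); apply/matrixP => l m.
  rewrite !mxE; have := congr1 (fun p : {poly R} => p`_m) (aE l).
  rewrite /= coefXn eq_sym => ->.
  rewrite coef_sum (reindex _ (onW_bij _ (enum_val_bij T))).
  by apply: eq_bigr => r _; rewrite coefZ !mxE.
have Mfree : row_free M.
  rewrite /row_free eqn_leq rank_leq_row /= (leq_trans (eq_leq cT))//.
  by rewrite -[X in (X <= _)%N](mxrank1 R d.+1) -CM mxrankM_maxr.
(* A zero piece would be a zero row of [M]. *)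
pose t : T := Tagged (fun i => 'I_(L i)) (Ordinal jL).
have : delta_mx 0 (enum_rank t) *m M = 0 :> 'rV_d.+1.
  by rewrite -rowE; apply/rowP => l; rewrite !mxE enum_rankK /pc/= Pij0 coef0.
move/(congr1 (mulmxr (pinvmx M))); rewrite /= -mulmxA mulmxVp// mulmx1 mul0mx.
by move/rowP/(_ (enum_rank t))/eqP; rewrite !mxE !eqxx oner_eq0.
Qed.

Lemma generating_of_deriv D d (F Q : int -> {poly R}) :
  mspline D d Q -> mspline D d F -> ~~ D 0%N ->
  (forall k, (F k)^`() = (Q k)^`()) -> exists C, forall k, Q k = F k + C%:P.
Proof. by move=> [_ jQ] [_ jF] D0; apply: pieces_of_deriv => k; auto. Qed.

(** * The increment step on pieces *)

(** The pieces of the increment of the collection [P]. *)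
Definition incr_pieces K (P : 'I_K -> int -> {poly R}) (L : 'I_K -> nat)
    (s0 : 'I_K) : 'I_K -> int -> {poly R} := fun i =>
  if i == s0 then fun k => prim (P s0) k - prim (P s0) (k - 1)
  else if cumul (P i) (L i) == 0 then prim (P i)
  else fun k => prim (P i) k - prim (P s0) k.

Lemma prim_difference_supported L P :
  supported L P -> supported L.+1 (fun k => prim P k - prim P (k - 1)).
Proof.
move=> sP k; have [k0|k0] := ltP k 0.
  by rewrite !prim_neg ?subrr//; lia.
by move=> hk; rewrite !(prim_tail sP) ?subrr//; lia.
Qed.

Lemma eq_conv M c c' P P' k : c =1 c' -> P =1 P' ->
  conv M c P k = conv M c' P' k.
Proof. by move=> cc PP; apply: eq_bigr => j _; rewrite cc PP. Qed.

Lemma telescope_int (V : zmodType) (G : int -> V) n :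
  \sum_(j < n.+1) (G j%:Z - G (j%:Z - 1)) = G n - G (-1).
Proof.
elim: n => [|n IH]; first by rewrite big_ord1 sub0r.
have nE : n.+1%:Z - 1 = n by lia.
by rewrite big_ord_recr IH /= nE addrC addrA subrK.
Qed.

Lemma antideriv_const (a : R) : antideriv a%:P = a *: 'X.
Proof.
apply/polyP => -[|[|i]]; rewrite coef_antideriv coefZ coefX coefC /=.
- by rewrite invr0 !mulr0.
- by rewrite divr1 mulr1.
- by rewrite mul0r mulr0.
Qed.

Lemma antiderivB p q : antideriv (p - q) = antideriv p - antideriv q.
Proof. by apply/polyP => i; rewrite !(coef_antideriv, coefB) mulrBl. Qed.

Lemma cumul_difference L P : supported L P ->
  cumul (fun k => prim P k - prim P (k - 1)) L.+1 = cumul P L.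
Proof.
move=> sP; rewrite /cumul.
under eq_bigr do rewrite antiderivB hornerD hornerN.
rewrite (telescope_int (fun k => (antideriv (prim P k)).[1])) (prim_tail sP)//.
by rewrite antideriv_const antideriv0 !hornerE subr0.
Qed.

(** The integer shifts of the backward difference of a primitive add up to the
    mean. *)
Lemma conv_const_difference M L a P k : supported L P -> (L <= M)%N ->
  conv M.+1 (fun=> a) (fun k => prim P k - prim P (k - 1)) k =
  (a * cumul P L)%:P.
Proof.
move=> sP LM; rewrite /conv -scaler_sumr (telescope_int (prim P)) subr0.
by rewrite (prim_tail sP) ?lez_nat// -mul_polyC polyCM.
Qed.

Section Increment.
Variables (D : pred nat) (d K : nat) (P : 'I_K -> int -> {poly R}).
Variables (L : 'I_K -> nat) (s0 : 'I_K).
Hypothesis h : mBpieces D d P L.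
Hypothesis m01 : forall i, cumul (P i) (L i) = 0 \/ cumul (P i) (L i) = 1.
Hypothesis ms0 : cumul (P s0) (L s0) = 1.
Hypothesis Ls0 : forall i, cumul (P i) (L i) != 0 -> (L s0 <= L i)%N.

Let th := incr_pieces P L s0.
Let L' i := (L i + (i == s0))%N.
Let Pneg i k : k < 0 -> P i k = 0 := @supported_lt0 _ _ k (mBp_supp h i).

Lemma incr_supported i : supported (L' i) (th i).
Proof.
rewrite /th /L' /incr_pieces; case: eqVneq => [->|_].
  by rewrite addn1; apply: prim_difference_supported; exact: mBp_supp h s0.
rewrite addn0; case: eqVneq => [m0|m0] k hk; have [k0|k0] := ltP k 0.
- by rewrite prim_neg.
- rewrite (prim_tail (mBp_supp h i)) ?m0//; lia.
- by rewrite !prim_neg ?subrr.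
have Lle := Ls0 m0.
rewrite (prim_tail (mBp_supp h i)) ?(prim_tail (mBp_supp h s0)); [|lia|lia].
by case: (m01 i) m0 => ->; rewrite ?eqxx// ms0 subrr.
Qed.

Lemma incr_mspline i : mspline (raise D) d.+1 (th i).
Proof.
have mp j := prim_mspline (@Pneg j) (mBp_spline h j).
rewrite /th /incr_pieces; case: eqP => _.
  by apply: msplineB => //; apply: mspline_translate.
by case: eqP => _ //; apply: msplineB.
Qed.

Lemma sum_incr_size : (\sum_i L' i = d.+2)%N.
Proof.
rewrite big_split /= (mBp_size h) (bigD1 s0)//= eqxx big1 ?addn0 ?addn1//.
by move=> i /negbTE ->.
Qed.

Lemma incr_supp i : supported d.+2 (th i).
Proof.
apply: supportedW (@incr_supported i) _.
by rewrite -sum_incr_size (bigD1 i)//= leq_addr.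
Qed.

Lemma incr_generating : generating (raise D) d.+1 th.
Proof.
move=> Q mQ; have [c cE] := mBp_gen h (mspline_deriv mQ).
(* The right-hand side also has to cancel the copies of [P s0] subtracted in
   the components of nonzero mean. *)
have [e eE] := difference_eq (fun k => c s0 k +
  \sum_(i | (i != s0) && (cumul (P i) (L i) != 0)) c i k).
(* Adding the constant [a] to the coefficients of the component [s0] adds [a]
   to the function. *)
pose f a i := if i == s0 then fun k => e k + a else c i.
pose F k := \sum_i conv d.+2 (f 0 i) (th i) k.
have mF : mspline (raise D) d.+1 F.
  apply: mspline_sum => i.
  by apply: conv_mspline; [exact: incr_supp|exact: incr_mspline].
have PW i c' k : conv d.+1 c' (P i) k = conv d.+2 c' (P i) k.
  rewrite (conv_widen _ _ (mBp_supp h i) (mBp_le i h)).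
  by rewrite (conv_widen _ _ (mBp_supp h i) (leqW (mBp_le i h))).
have dF k : (F k)^`() = (Q k)^`().
  rewrite cE; under [RHS]eq_bigr do rewrite PW.
  have -> : (F k)^`() = \sum_i conv d.+2 (f 0 i) (fun k => (th i k)^`()) k.
    by rewrite raddf_sum; apply: eq_bigr => i _; apply: deriv_conv.
  rewrite (bigD1 s0)//= [RHS](bigD1 s0)//=.
  have -> : conv d.+2 (f 0 s0) (fun k => (th s0 k)^`()) k =
    conv d.+2 (c s0) (P s0) k +
    \sum_(i | (i != s0) && (cumul (P i) (L i) != 0)) conv d.+2 (c i) (P s0) k.
    rewrite -conv_sumc -convD -[RHS](eq_conv _ _ eE (frefl _)) -conv_diff.
      apply: eq_conv => l; first by rewrite /f eqxx /= addr0.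
      by rewrite /th /incr_pieces eqxx derivB !(deriv_prim _ (@Pneg s0)).
    exact: supportedW (mBp_supp h s0) (mBp_le s0 h).
  rewrite -addrA; congr (_ + _); rewrite big_mkcondr /= -big_split /=.
  apply: eq_bigr => i /negbTE is0; rewrite /f is0 /th /incr_pieces is0.
  case: eqVneq => m0 /=.
    by rewrite add0r; apply: eq_conv => l //; rewrite (deriv_prim _ (@Pneg i)).
  rewrite addrC -[RHS](subrK (conv d.+2 (c i) (P s0) k)); congr (_ + _).
  rewrite -convB; apply: eq_conv => l //.
  by rewrite derivB (deriv_prim _ (@Pneg i)) (deriv_prim _ (@Pneg s0)).
have [C CE] := generating_of_deriv mQ mF isT dF.
exists (f C) => k; rewrite CE /F (bigD1 s0)//= [RHS](bigD1 s0)//= addrAC.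
congr (_ + _); last by apply: eq_bigr => i /negbTE is0; rewrite /f is0.
rewrite /f eqxx convD [in RHS]convD -!addrA; congr (_ + _).
have cC a : conv d.+2 (fun=> a) (th s0) k = a%:P.
  rewrite /th /incr_pieces eqxx (conv_const_difference _ _ (mBp_supp h s0)).
    by rewrite ms0 mulr1.
  exact: mBp_le h.
by rewrite !cC add0r.
Qed.

Lemma incr_mBpieces : mBpieces (raise D) d.+1 th L'.
Proof.
split.
- exact: incr_supported.
- by move=> i; rewrite addn_gt0 (mBp_pos h).
- exact: sum_incr_size.
- exact: incr_mspline.
- exact: incr_generating.
exists s0; rewrite /th /incr_pieces /L' eqxx addn1.
by rewrite (cumul_difference (mBp_supp h s0)) ms0 oner_eq0.
Qed.
End Increment.

(** * The insertion step on pieces *)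

(** The degree set [D + 1] with 0 added. *)
Definition raise0 D : pred nat := fun j => if j is i.+1 then D i else true.

(** The pieces of the box function. *)
Definition unit_cell (k : int) : {poly R} := if k == 0 then 1 else 0.

(** The pieces of the indicator of the nonnegative half-line. *)
Definition step_pieces (k : int) : {poly R} := if 0 <= k then 1 else 0.

Lemma mspline_const D d (e : int -> R) :
  D 0%N -> mspline D d (fun k => (e k)%:P).
Proof.
move=> D0; split=> [k|k [|j] Dj]; first 2 last.
- by rewrite /jump comp_polyC -polyCB coefC.
- by rewrite (leq_trans (size_polyC_leq1 _)).
- by rewrite D0 in Dj.
Qed.

Lemma mspline_raise0 D d Q : mspline (raise D) d Q -> mspline (raise0 D) d Q.
Proof. by move=> [sQ jQ]; split=> // k [|j] //= Dj; apply: jQ. Qed.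

Lemma unit_cellE k : unit_cell k = (if k == 0 then 1 else 0 : R)%:P.
Proof. by rewrite /unit_cell; case: eqP. Qed.

Lemma step_piecesE k : step_pieces k = (if 0 <= k then 1 else 0 : R)%:P.
Proof. by rewrite /step_pieces; case: ifP. Qed.

Lemma eq_mspline D d P Q : P =1 Q -> mspline D d P -> mspline D d Q.
Proof.
move=> PQ [sP jP]; split=> [k|k j Dj]; first by rewrite -PQ.
by have := jP k j Dj; rewrite /jump !PQ.
Qed.

Lemma unit_cell_mspline D d : D 0%N -> mspline D d unit_cell.
Proof.
move=> D0.
apply: eq_mspline (mspline_const d (fun k => if k == 0 then 1 else 0) D0).
by move=> k; rewrite unit_cellE.
Qed.

Lemma step_pieces_mspline D d : D 0%N -> mspline D d step_pieces.
Proof.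
move=> D0.
apply: eq_mspline (mspline_const d (fun k => if 0 <= k then 1 else 0) D0).
by move=> k; rewrite step_piecesE.
Qed.

Lemma unit_cell_supported : supported 1 unit_cell.
Proof. by move=> k hk; rewrite /unit_cell; case: eqP hk => // ->. Qed.

Lemma conv_unit_cell M e k : (0 < M)%N -> conv M e unit_cell k = (e k)%:P.
Proof.
move=> M0; rewrite (conv_widen _ _ unit_cell_supported M0) /conv big_ord1 subr0.
by rewrite /unit_cell eqxx -alg_polyC.
Qed.

Lemma cumul_unit_cell : cumul unit_cell 1 = 1.
Proof.
by rewrite /cumul big_ord1 unit_cellE eqxx antideriv_const !hornerE.
Qed.

(** The pieces of the insertion applied to the collection [P]. *)
Definition ins_pieces K (P : 'I_K -> int -> {poly R}) (L : 'I_K -> nat) :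
    'I_K.+1 -> int -> {poly R} := fun s =>
  if unlift ord0 s is Some i then
    if cumul (P i) (L i) == 0 then prim (P i)
    else fun k => prim (P i) k - step_pieces k
  else unit_cell.

Section Insertion.
Variables (D : pred nat) (d K : nat) (P : 'I_K -> int -> {poly R}).
Variables (L : 'I_K -> nat).
Hypothesis h : mBpieces D d P L.
Hypothesis m01 : forall i, cumul (P i) (L i) = 0 \/ cumul (P i) (L i) = 1.

Let th := ins_pieces P L.
Let L' (s : 'I_K.+1) := if unlift ord0 s is Some i then L i else 1%N.
Let Pneg i k : k < 0 -> P i k = 0 := @supported_lt0 _ _ k (mBp_supp h i).

Lemma ins_supported s : supported (L' s) (th s).
Proof.
rewrite /th /L' /ins_pieces; case: unliftP => [i _|_]; last first.
  exact: unit_cell_supported.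
case: eqVneq => [m0|m0] k hk; have [k0|k0] := ltP k 0.
- by rewrite prim_neg.
- by rewrite (prim_tail (mBp_supp h i)) ?m0//; lia.
- by rewrite prim_neg// /step_pieces leNgt k0 subrr.
rewrite (prim_tail (mBp_supp h i)) ?m0//; last by lia.
by rewrite /step_pieces k0; case: (m01 i) m0 => ->; rewrite ?eqxx// subrr.
Qed.

Lemma ins_mspline s : mspline (raise0 D) d.+1 (th s).
Proof.
rewrite /th /ins_pieces; case: unliftP => [i _|_]; last first.
  exact: unit_cell_mspline.
have mp := mspline_raise0 (prim_mspline (@Pneg i) (mBp_spline h i)).
by case: eqP => _ //; apply: msplineB => //; apply: step_pieces_mspline.
Qed.

Lemma sum_ins_size : (\sum_s L' s = d.+2)%N.
Proof.
rewrite big_ord_recl /L' unlift_none add1n -(mBp_size h); congr (_.+1).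
by apply: eq_bigr => i _; rewrite liftK.
Qed.

Lemma ins_generating : generating (raise0 D) d.+1 th.
Proof.
move=> Q mQ; have [c cE] := mBp_gen h (mspline_deriv mQ).
pose F k := \sum_(i < K) conv d.+2 (c i) (th (lift ord0 i)) k.
have dF k : (F k)^`() = (Q k)^`().
  rewrite cE raddf_sum; apply: eq_bigr => i _ /=; rewrite deriv_conv.
  rewrite (eq_conv (P' := P i) _ _ (frefl _)) => [|l].
    rewrite (conv_widen _ _ (mBp_supp h i) (mBp_le i h)).
    by rewrite (conv_widen _ _ (mBp_supp h i) (leqW (mBp_le i h))).
  rewrite /th /ins_pieces liftK; case: ifP => _.
    exact: deriv_prim (@Pneg i).
  by rewrite derivB step_piecesE derivC subr0; apply: deriv_prim (@Pneg i).
(* The remaining piecewise constant part, to be carried by the box. *)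
pose e k := (Q k - F k)`_0.
exists (fun s => if unlift ord0 s is Some i then c i else e) => k.
rewrite big_ord_recl unlift_none /th {1}/ins_pieces unlift_none conv_unit_cell//.
rewrite [X in _ + X](_ : _ = F k); last first.
  by apply: eq_bigr => i _; rewrite liftK.
by rewrite -poly_deriv_eq0 ?subrK// derivB dF subrr.
Qed.

Lemma ins_mBpieces : mBpieces (raise0 D) d.+1 th L'.
Proof.
split.
- exact: ins_supported.
- by move=> s; rewrite /L'; case: unliftP => [i _|//]; exact: (mBp_pos h).
- exact: sum_ins_size.
- exact: ins_mspline.
- exact: ins_generating.
exists ord0; rewrite /th /ins_pieces /L' unlift_none cumul_unit_cell.
exact: oner_neq0.
Qed.
End Insertion.

Lemma unit_cell_mBpieces (D : pred nat) : D 0%N ->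
  mBpieces D 0 (fun _ : 'I_1 => unit_cell) (fun=> 1%N).
Proof.
move=> D0; split => //.
- by move=> i; apply: unit_cell_supported.
- by rewrite big_ord1.
- by move=> i; apply: unit_cell_mspline.
- move=> Q [sQ _]; exists (fun _ k => (Q k)`_0) => k.
  by rewrite big_ord1 conv_unit_cell// -size1_polyC.
- by exists ord0; rewrite cumul_unit_cell oner_neq0.
Qed.

Lemma supportedZ M a P : supported M P -> supported M (fun k => a *: P k).
Proof. by move=> sP k hk; rewrite sP ?scaler0. Qed.

Lemma cumulZ a P n : cumul (fun k => a *: P k) n = a * cumul P n.
Proof.
by rewrite /cumul mulr_sumr; apply: eq_bigr => j _; rewrite antiderivZ hornerZ.
Qed.

Lemma scale_mBpieces D d K (P : 'I_K -> int -> {poly R}) L (a : 'I_K -> R) :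
  (forall i, a i != 0) -> mBpieces D d P L ->
  mBpieces D d (fun i k => a i *: P i k) L.
Proof.
move=> a0 h; split.
- by move=> i; apply/supportedZ/(mBp_supp h).
- exact: mBp_pos h.
- exact: mBp_size h.
- by move=> i; apply/msplineZ/(mBp_spline h).
- move=> Q /(mBp_gen h)[c cE]; exists (fun i k => c i k / a i) => k.
  rewrite cE; apply: eq_bigr => i _; apply: eq_bigr => j _.
  by rewrite scalerA divfK.
- by have [i mi] := mBp_mean h; exists i; rewrite cumulZ mulf_neq0.
Qed.

Lemma eq_mBpieces D D' d K (P : 'I_K -> int -> {poly R}) L : D =1 D' ->
  mBpieces D d P L -> mBpieces D' d P L.
Proof.
move=> DD h; have ms Q : mspline D d Q <-> mspline D' d Q.
  by split=> -[sQ jQ]; split=> // k j Dj; apply: jQ; rewrite DD// -DD in Dj *.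
split; [exact: mBp_supp h|exact: mBp_pos h|exact: mBp_size h| | |exact: mBp_mean h].
- by move=> i; apply/ms/(mBp_spline h).
- by move=> Q /ms /(mBp_gen h).
Qed.

End Pieces.
Arguments mBp_supp {R D d K P L} h i : rename.
Arguments mBp_mean {R D d K P L} h : rename.

(** * From pieces to functions: values and integrals *)

Section Realize.
Variable R : realType.
Local Notation mu := (@lebesgue_measure R).
Implicit Types (p q : {poly R}) (P Q : int -> {poly R}).

(** The function with pieces [Q]. *)
Definition realize Q (x : R) : R :=
  (Q (Num.floor x)).[x - (Num.floor x)%:~R].

Lemma realizeE Q (k : int) x :
  k%:~R <= x < (k + 1)%:~R -> realize Q x = (Q k).[x - k%:~R].
Proof. by move=> kx; rewrite /realize (floor_def kx). Qed.

Lemma floor_cell (x : R) : (Num.floor x)%:~R <= x < (Num.floor x + 1)%:~R.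
Proof. exact: floor_itv. Qed.

Lemma realize_translate Q (j : int) x :
  realize Q (x - j%:~R) = realize (fun k => Q (k - j)) x.
Proof.
have := floor_cell x; set k := Num.floor x => /andP[kx xk].
rewrite (@realizeE Q (k - j)) ?(@realizeE _ k) ?kx//.
  by congr (_.[_]); rewrite intrB; ring.
by rewrite !(intrD, intrN) in xk *; apply/andP; split; lra.
Qed.

Lemma realize_supported M P x : supported M P ->
  ~~ (0 <= x < M%:R) -> realize P x = 0.
Proof.
move=> sP hx; rewrite /realize sP ?horner0//; apply: contra hx => /andP[h1 h2].
have /andP[kx xk] := floor_cell x.
rewrite (le_trans _ kx) ?ler0z//= (lt_le_trans xk)//.
by rewrite -[M%:R]/(M%:Z%:~R) ler_int; lia.
Qed.

Lemma cell_shift p (a x : R) : (p \Po ('X - a%:P)).[x] = p.[x - a].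
Proof. by rewrite horner_comp !hornerE. Qed.

Lemma deriv_cell_shift p (a : R) :
  (p \Po ('X - a%:P))^`() = p^`() \Po ('X - a%:P).
Proof. by rewrite deriv_comp derivB derivX derivC subr0 mulr1. Qed.

Lemma integrable_horner p (i : interval R) (a b : R) :
  [set` i] `<=` `[a, b] -> mu.-integrable [set` i] (EFin \o horner p).
Proof.
move=> iab; apply: (@integrableS _ _ _ mu `[a, b]%classic) => //.
apply: continuous_compact_integrable; first exact: segment_compact.
by apply: continuous_subspaceT; exact: continuous_horner.
Qed.

Lemma Rintegral_deriv p (a b : R) : a <= b ->
  \int[mu]_(x in `[a, b]) p^`().[x] = p.[b] - p.[a].
Proof.
rewrite le_eqVlt => /predU1P[<-|ab].
  by rewrite set_itv1 Rintegral_set1 subrr.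
rewrite /Rintegral (@continuous_FTC2 _ _ (horner p))//.
- by apply: continuous_subspaceT; exact: continuous_horner.
- split.
  + by move=> x _; exact: derivable_horner.
  + by apply: cvg_at_right_filter; exact: continuous_horner.
  + by apply: cvg_at_left_filter; exact: continuous_horner.
- by move=> x _; rewrite derivE.
Qed.

Lemma realize_sum M P x : supported M P -> realize P x =
  \sum_(j < M) ((horner (P j%:Z \Po ('X - (j%:R)%:P)))
     \_ `[j%:R, j.+1%:R[%classic) x.
Proof.
move=> sP; have /andP[kx xk] := floor_cell x.
set k := Num.floor x in kx xk *.
have cellE (j : nat) : (x \in `[(j%:R : R), j.+1%:R[%classic) = (j%:Z == k).
  rewrite mem_setE in_itv /=; apply/andP/eqP => [[jx xj]|jk].
    apply/esym/floor_def; rewrite -[_%:~R]/(j%:R) jx.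
    by rewrite intrD -[j%:~R]/(j%:R : R) natr1.
  rewrite -jk in kx xk; rewrite -[_%:R in X in X <= _]/(j%:Z%:~R) kx.
  by rewrite intrD -[j%:~R]/(j%:R : R) natr1 in xk.
have [hk|hk] := boolP (0 <= k < M%:Z); last first.
  rewrite /realize sP// horner0 big1// => j _; rewrite patchE cellE.
  by case: eqP hk => // <-; have := ltn_ord j; lia.
have kM : (`|k| < M)%N by lia.
have kE : `|k|%N%:Z = k by lia.
rewrite (bigD1 (Ordinal kM))//= patchE cellE kE eqxx big1 => [|j jk].
  by rewrite addr0 cell_shift /realize -/k -kE.
rewrite patchE cellE; case: eqP => // jE.
by case/eqP: jk; apply/val_inj => /=; lia.
Qed.

Lemma realize_integrable M P : supported M P ->
  mu.-integrable setT (EFin \o realize P).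
Proof.
move=> sP; pose g (j : nat) :=
  (horner (P j%:Z \Po ('X - (j%:R)%:P))) \_ `[j%:R, j.+1%:R[%classic.
rewrite (_ : _ \o _ = fun x => (\sum_(j < M) (g j x)%:E)%E); last first.
  by apply/funext => x /=; rewrite (realize_sum x sP) sumEFin.
apply: integrable_sum => // j _.
rewrite (_ : (fun x => _) = EFin \o g j)// /g -restrict_EFin.
apply/(integrable_mkcond _ _).1 => //.
by apply: (@integrable_horner _ _ j%:R j.+1%:R); exact: subset_itv_co_cc.
Qed.

End Realize.

Section Integrals.
Variable R : realType.
Local Notation mu := (@lebesgue_measure R).
Implicit Types (p q : {poly R}) (P Q : int -> {poly R}).

Lemma Rintegral_cell M P (k : nat) (b : R) : supported M P ->
  k%:R <= b <= k.+1%:R ->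
  \int[mu]_(x in `]k%:R, b]) realize P x = (antideriv (P k)).[b - k%:R].
Proof.
move=> sP /andP[kb bk].
have iP (i : interval R) : mu.-integrable [set` i] (EFin \o realize P).
  by apply: integrableS (realize_integrable sP).
rewrite -Rintegral_itv_bndo_bndc//.
pose q := antideriv (P k) \Po ('X - (k%:R : R)%:P).
rewrite (@eq_Rintegral _ (measurableTypeR R) R mu _ (horner q^`())); last first.
  move=> x; rewrite inE/= in_itv/= => /andP[kx xb].
  rewrite (@realizeE _ _ k%:Z) ?(ltW kx)//=; last first.
    by rewrite intrD -[k%:~R]/(k%:R : R) natr1 (lt_le_trans xb).
  by rewrite /q deriv_cell_shift deriv_antideriv cell_shift.
have iq (i : interval R) : [set` i] `<=` `[k%:R : R, b] ->
    mu.-integrable [set` i] (EFin \o horner q^`()).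
  exact: integrable_horner.
rewrite Rintegral_itv_bndo_bndc; last exact/iq/subset_itv_oo_cc.
rewrite Rintegral_itv_obnd_cbnd; last exact/iq/subset_itv_oc_cc.
by rewrite Rintegral_deriv// /q !cell_shift subrr antideriv0_horner subr0.
Qed.

Lemma primitive_le0 M P x : supported M P -> x <= 0 ->
  primitive (realize P) x = 0.
Proof.
move=> sP x0; rewrite /primitive -Rintegral_itv_bndo_bndc; last first.
  by apply: integrableS (realize_integrable sP).
rewrite (@eq_Rintegral _ (measurableTypeR R) R mu _ (cst 0)).
  by rewrite Rintegral_cst ?mul0r.
move=> y.
rewrite inE/= in_itv/= => yx; apply: realize_supported sP _.
by rewrite leNgt (lt_le_trans yx).
Qed.

Lemma primitive_step M P (k : nat) x : supported M P ->
  k%:R <= x <= k.+1%:R -> primitive (realize P) x =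
  primitive (realize P) k%:R + (antideriv (P k)).[x - k%:R].
Proof.
move=> sP kx; rewrite -(Rintegral_cell sP kx) /primitive.
have /andP[k_x _] := kx.
rewrite -(@Rintegral_itvB _ _ -oo%O (BRight x) k%:R) ?bnd_simp//.
  by rewrite addrC subrK.
by apply: integrableS (realize_integrable sP).
Qed.

Lemma primitive_nat M P (k : nat) : supported M P ->
  primitive (realize P) k%:R = cumul P k.
Proof.
move=> sP; elim: k => [|k IH].
  by rewrite (primitive_le0 sP)// /cumul big_ord0.
have kk : k%:R <= (k.+1%:R : R) <= k.+1%:R by rewrite lexx andbT ler_nat.
rewrite (primitive_step sP kk) IH.
by rewrite -natr1 addrAC subrr add0r /cumul big_ord_recr.
Qed.

Lemma primitive_realize M P : supported M P ->
  primitive (realize P) = realize (prim P).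
Proof.
move=> sP; apply/funext => x; have := floor_cell x.
have [x0 _|x0] := ltP x 0.
  rewrite (primitive_le0 sP) ?ltW// /realize prim_neg ?horner0//.
  by rewrite floor_lt0.
have : 0 <= Num.floor x by rewrite floor_ge0.
rewrite [realize _ _]/realize; case: (Num.floor x) => // k _ /andP[kx xk].
rewrite -[_%:~R]/(k%:R : R) in kx *.
rewrite intrD -[k%:~R]/(k%:R : R) natr1 in xk.
rewrite (@primitive_step M P k) ?kx ?ltW// (primitive_nat _ sP) /=.
by rewrite hornerD hornerC.
Qed.

Lemma Rintegral_realize M P : supported M P ->
  \int[mu]_x realize P x = cumul P M.
Proof.
move=> sP; rewrite -(primitive_nat _ sP) /primitive [RHS]Rintegral_mkcond.
apply: eq_Rintegral => x _; rewrite patchE; case: ifPn => //.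
rewrite mem_setE in_itv/= -ltNge => Mx; apply: realize_supported sP _.
by rewrite [x < _]ltNge (ltW Mx) andbF.
Qed.

(** Among [size p] distinct points of the interval, one is not a root. *)
Lemma horner_neq0_dense p (a b : R) : p != 0 -> a < b ->
  exists2 x, a < x < b & p.[x] != 0.
Proof.
(* Infinitely many distinct points of the open interval. *)
move=> p0 ab; pose f (i : nat) := a + (b - a) / (i.+2)%:R.
have f_in i : a < f i < b.
  have ba : 0 < b - a by rewrite subr_gt0.
  rewrite ltrDl divr_gt0//= -ltrBrDl ltr_pdivrMr// ltr_pMr//.
  by rewrite ltr1n.
pose s := map f (iota 0 (size p)).
have us : uniq s.
  have ba : b - a != 0 by rewrite subr_eq0 gt_eqF.
  rewrite map_inj_uniq ?iota_uniq// => i j /addrI/(mulfI ba)/invr_inj/eqP.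
  by rewrite eqr_nat => /eqP[].
have [|/allPn[y /mapP[i _ ->] py]] := boolP (all (root p) s); last first.
  by exists (f i).
by move=> /(max_poly_roots p0)/(_ us); rewrite size_map size_iota ltnn.
Qed.

(** Every point of [0, L] is a limit of points of a cell where the corresponding
    piece does not vanish. *)
Lemma supp_realize L P : supported L P -> (forall j, (j < L)%N -> P j%:Z != 0) ->
  (0 < L)%N -> supp (realize P) = `[0, L%:R]%classic.
Proof.
move=> sP P0 L0; rewrite eqEsubset; split.
  rewrite /supp (_ : `[0, L%:R]%classic = closure (`[0, L%:R]%classic : set R)).
    apply: closure_subset => x /=; rewrite in_itv/=; apply: contraNT => hx.
    apply/eqP/(realize_supported sP); apply: contra hx => /andP[-> /ltW].
    by [].
  by apply/closure_id; exact: itv_closed.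
move=> x /=; rewrite in_itv/= => /andP[x0 xL] B /nbhs_ballP[e /= e0 eB].
have [j jL /andP[jx xj]] : exists2 j : nat, (j < L)%N & j%:R <= x <= j.+1%:R.
  have [xL'|Lx] := ltP x L%:R.
    have /andP[kx xk] := floor_cell x; have := x0; rewrite -floor_ge0.
    case: (Num.floor x) kx xk => // k kx xk _; exists k.
      by rewrite -(ltr_nat R) (le_lt_trans kx).
    rewrite -[k%:R]/(k%:Z%:~R) kx ltW//.
    by rewrite intrD -[k%:~R]/(k%:R : R) natr1 in xk.
  exists L.-1; rewrite ?prednK// xL andbT (le_trans _ Lx)// ler_nat.
  exact: leq_pred.
have ab : Num.max j%:R (x - e) < Num.min (j.+1%:R) (x + e).
  rewrite lt_min !gt_max ltr_nat leqnn /=; apply/and3P; split; lra.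
have Pj : P j \Po ('X - (j%:R : R)%:P) != 0.
  by rewrite comp_poly2_eq0 ?size_XsubC// P0.
have [z /andP[]] := horner_neq0_dense Pj ab.
rewrite gt_max lt_min => /andP[jz ez] /andP[zj ze] Pz; exists z; split => /=.
  rewrite (@realizeE _ _ j%:Z) ?(ltW jz) -?cell_shift//=.
  by rewrite intrD -[j%:~R]/(j%:R : R) natr1.
by apply: eB; rewrite /ball/= ltr_norml; apply/andP; split; lra.
Qed.

Lemma supp_size_realize L P : supported L P ->
  (forall j, (j < L)%N -> P j%:Z != 0) -> (0 < L)%N ->
  supp_size (realize P) = L%:R%:E.
Proof.
move=> sP P0 L0; rewrite /supp_size (supp_realize sP P0 L0) lebesgue_measure_itv/=.
by rewrite lte_fin ltr0n L0 oppr0 adde0.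
Qed.

Lemma Lfun2_realize M P : supported M P ->
  realize P \in Lfun mu 2%:E.
Proof.
move=> sP.
have iP := realize_integrable sP.
(* The square of the function is again a compactly supported piecewise
   polynomial. *)
have iP2 : mu.-integrable setT (EFin \o realize (fun k => P k ^+ 2)).
  by apply: (@realize_integrable _ M) => k hk; rewrite sP// expr0n.
have mP : measurable_fun setT (realize P).
  by apply/measurable_EFinP; case/integrableP: iP.
rewrite inE; apply/andP; split; rewrite inE//=.
rewrite /finite_norm; apply: (@lty_poweRy _ _ 2); first by rewrite pnatr_eq0.
rewrite poweR_Lnorm ?pnatr_eq0//; case/integrableP: iP2 => _.
congr (_ < _)%E; apply: eq_integral => x _ /=.
by rewrite /realize horner_exp normrX -powR_mulrn.
Qed.
End Integrals.

(** * Increment and insertion steps on functions *)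

Section Steps.
Variable R : realType.
Local Notation mu := (@lebesgue_measure R).
Implicit Types (p q : {poly R}) (Q : int -> {poly R}).

Lemma inf_support_realize M Q : supported M Q -> Q 0 != 0 ->
  (0 <= ereal_inf (EFin @` [set t | realize Q t != 0%R]) < 1)%E.
Proof.
move=> sQ Q0; apply/andP; split.
  apply/ereal_infP => _ [t /= Qt <-]; rewrite lee_fin leNgt.
  apply: contraNN Qt => t0; apply/eqP/(realize_supported sQ).
  by rewrite leNgt t0.
have [z /andP[z0 z1] Qz] := horner_neq0_dense Q0 (@ltr01 R).
rewrite (@le_lt_trans _ _ z%:E) ?lte_fin//.
apply: ereal_inf_lbound; exists z => //=.
by rewrite (@realizeE _ _ 0) ?subr0// ltW.
Qed.

Section Step.
Variables (D : pred nat) (d K : nat) (P : 'I_K -> int -> {poly R}).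
Variable L : 'I_K -> nat.
Hypothesis h : mBpieces D d P L.

(** The factors that bring the nonzero means to 1; no translation is needed, as
    the supports start at 0. *)
Let a i : R := if cumul (P i) (L i) == 0 then 1 else (cumul (P i) (L i))^-1.
Let P1 i k := a i *: P i k.

Let a_neq0 i : a i != 0.
Proof. by rewrite /a; case: ifPn => [_|?]; rewrite ?oner_eq0 ?invr_eq0. Qed.

Let h1 : mBpieces D d P1 L. Proof. exact: scale_mBpieces. Qed.

Let mean01 i : cumul (P1 i) (L i) = 0 \/ cumul (P1 i) (L i) = 1.
Proof.
rewrite /P1 cumulZ /a; case: eqVneq => [->|m0]; first by left; rewrite mulr0.
by right; rewrite mulVf.
Qed.

Let intE i : \int[mu]_t realize (P1 i) t = cumul (P1 i) (L i).
Proof. exact: (Rintegral_realize (mBp_supp h1 i)). Qed.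

Lemma standardization_pieces :
  standardization (fun i => realize (P i)) (fun i => realize (P1 i)).
Proof.
split=> i; last first.
  exists (a i) => //; exists 0 => x; rewrite subr0.
  by rewrite /realize /P1 hornerZ.
split.
- rewrite /compactly_supported (supp_realize (mBp_supp h1 i)).
  + exact: segment_compact.
  + by move=> j; exact: mBpieces_neq0 h1.
  + exact: (mBp_pos h1).
- by rewrite intE; exact: mean01.
- apply: inf_support_realize (mBp_supp h1 i) _.
  exact: (mBpieces_neq0 h1 (mBp_pos h1 i)).
Qed.

Lemma constructible_incr_pieces : constructible (fun i => realize (P i)) ->
  exists P' L', mBpieces (raise D) d.+1 P' L' /\
    constructible (fun i : 'I_K => realize (R := R) (P' i)).
Proof.
move=> cP; have [i0 mi0] := mBp_mean h1.
pose s0 := [arg min_(i < i0 | cumul (P1 i) (L i) != 0) L i].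
have [ms0 Ls0] : cumul (P1 s0) (L s0) != 0 /\
    forall i, cumul (P1 i) (L i) != 0 -> (L s0 <= L i)%N.
  by rewrite /s0; case: arg_minnP.
have ms0' : cumul (P1 s0) (L s0) = 1.
  by case: (mean01 s0) ms0 => -> //; rewrite eqxx.
exists (incr_pieces P1 L s0); eexists; split.
  exact: (incr_mBpieces h1 mean01 ms0' Ls0).
have size1 i : supp_size (realize (P1 i)) = (L i)%:R%:E.
  apply: supp_size_realize (mBp_supp h1 i) _ (mBp_pos h1 i).
  by move=> j; exact: mBpieces_neq0 h1.
rewrite [X in constructible X](_ : _ = increment (fun i => realize (P1 i)) s0).
  apply: (constructible_increment cP standardization_pieces).
  split=> [|s]; rewrite !intE// => /Ls0; rewrite !size1 lee_fin ler_nat.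
  by [].
have prE i := primitive_realize (mBp_supp h1 i).
apply/funext => i; rewrite /increment /incr_pieces intE; case: eqP => _.
  apply/funext => x; rewrite prE /backward_difference /= (realize_translate _ 1).
  by rewrite /realize hornerD hornerN.
case: eqP => _; rewrite !prE//.
by apply/funext => x; rewrite /= /realize hornerD hornerN.
Qed.

Lemma realize_unit_cell : realize (@unit_cell R) = @box R.
Proof.
apply/funext => x; rewrite /realize /box /indic /unit_cell.
rewrite mem_setE in_itv/= (_ : (0 <= x < 1) = (Num.floor x == 0)).
  by case: eqP; rewrite hornerE.
apply/idP/eqP => [x01|x0]; first exact: floor_def.
by have := floor_cell x; rewrite x0.
Qed.

Lemma realize_step_pieces : realize (@step_pieces R) = \1_`[0, +oo[.
Proof.
apply/funext => x; rewrite /realize /indic /step_pieces floor_ge0.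
by rewrite mem_setE in_itv/= andbT; case: ifP; rewrite hornerE.
Qed.

Lemma constructible_ins_pieces : constructible (fun i => realize (P i)) ->
  exists P' L', mBpieces (raise0 D) d.+1 P' L' /\
    constructible (fun i : 'I_K.+1 => realize (R := R) (P' i)).
Proof.
move=> cP; exists (ins_pieces P1 L); eexists; split.
  exact: (ins_mBpieces h1 mean01).
rewrite [X in constructible X](_ : _ = insertion (fun i => realize (P1 i))).
  exact: (constructible_insertion cP standardization_pieces).
have prE i := primitive_realize (mBp_supp h1 i).
apply/funext => s; rewrite /insertion /ins_pieces; case: unliftP => [i _|_].
  rewrite intE; case: eqP => _; rewrite prE//.
  by apply/funext => x; rewrite -realize_step_pieces /= /realize hornerD hornerN.
exact: realize_unit_cell.
Qed.
End Step.

(** Every set of degrees with largest element [d] is reached by the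
    construction, with as many functions as there are degrees. *)
Lemma constructible_pieces d (D : pred nat) : D d ->
  exists P L, mBpieces D d P L /\
    constructible (fun i : 'I_(count D (iota 0 d.+1)) => realize (R := R) (P i)).
Proof.
elim: d D => [|d IH] D Dd.
  rewrite /= Dd; exists (fun=> @unit_cell R), (fun=> 1%N); split.
    exact: unit_cell_mBpieces.
  rewrite realize_unit_cell; exact: (constructible_bspline 0).
have [P [L [h cP]]] := IH (fun j => D j.+1) Dd.
have -> : count D (iota 0 d.+2) =
    (D 0 + count (fun j => D j.+1) (iota 0 d.+1))%N.
  have -> : iota 0 d.+2 = 0 :: [seq i.+1 | i <- iota 0 d.+1].
    by rewrite -[RHS]/(0 :: map (addn 1) (iota 0 d.+1)) -iotaDl.
  by rewrite /= count_map.
case D0: (D 0).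
  have [P' [L' [h' cP']]] := constructible_ins_pieces h cP.
  by exists P', L'; split=> //; apply: eq_mBpieces h' => -[].
have [P' [L' [h' cP']]] := constructible_incr_pieces h cP.
by exists P', L'; split=> //; apply: eq_mBpieces h' => -[].
Qed.
End Steps.

(** * Cardinal splines, their pieces, and truncated powers *)

Section Smooth.
Variable R : realType.
Implicit Types (p q : {poly R}) (Q : int -> {poly R}) (f g : R -> R).

(** Only the values of [f] on an open interval matter; no differentiability of
    [f] is assumed. *)
Lemma derive1n_eq_horner p f (a b : R) :
  (forall x, a < x < b -> f x = p.[x]) ->
  forall j x, a < x < b -> (f^`(j))%classic x = p^`(j).[x].
Proof.
move=> fp; elim=> [|j IH] x xab; first by rewrite derive1n0 fp.
rewrite derive1nS derivnS derivE !derive1E; apply: near_eq_derive.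
have : x \in `]a, b[ by rewrite in_itv.
move/near_in_itvoo; apply: filterS => y; rewrite in_itv/=; exact: IH.
Qed.

Lemma continuous_eq_horner_left q g (a b : R) : a < b -> continuous g ->
  (forall x, a < x < b -> g x = q.[x]) -> g b = q.[b].
Proof.
move=> ab cg gq.
have gb : g x @[x --> b^'-] --> g b by apply: cvg_at_left_filter; exact: cg.
have qb : q.[x] @[x --> b^'-] --> q.[b].
  by apply: cvg_at_left_filter; exact: continuous_horner.
apply: (cvg_unique _ gb) => //; apply: cvg_trans qb; apply: near_eq_cvg.
near=> x; rewrite gq//; apply/andP; split; near: x.
- exact: nbhs_left_gt.
- exact: nbhs_left_lt.
Unshelve. all: by end_near. Qed.

Lemma continuous_eq_horner_right q g (a b : R) : a < b -> continuous g ->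
  (forall x, a < x < b -> g x = q.[x]) -> g a = q.[a].
Proof.
move=> ab cg gq.
have ga : g x @[x --> a^'+] --> g a by apply: cvg_at_right_filter; exact: cg.
have qa : q.[x] @[x --> a^'+] --> q.[a].
  by apply: cvg_at_right_filter; exact: continuous_horner.
apply: (cvg_unique _ ga) => //; apply: cvg_trans qa; apply: near_eq_cvg.
near=> x; rewrite gq//; apply/andP; split; near: x.
- exact: nbhs_right_gt.
- exact: nbhs_right_lt.
Unshelve. all: by end_near. Qed.

Lemma coef_shift_eq0 p (a : R) j : p^`(j).[a] = 0 ->
  (p \Po ('X + a%:P))`_j = 0.
Proof.
have dcomp : (p \Po ('X + a%:P))^`(j) = p^`(j) \Po ('X + a%:P).
  elim: {+}j => [|i IH]; first by rewrite !derivn0.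
  by rewrite !derivnS IH deriv_comp derivD derivX derivC addr0 mulr1.
move=> pj; have := congr1 (horner^~ 0) dcomp.
rewrite /= horner_comp !hornerE pj horner_coef0 coef_derivn addn0 ffactnn.
by move/eqP; rewrite mulrn_eq0 -[j`!]prednK ?fact_gt0//= => /eqP.
Qed.

(** The derivatives of order less than [n] of neighbouring pieces agree at the
    knot they share, by continuity from both sides, so that their difference
    there is a multiple of the monomial of degree [n]. *)
Lemma cardinal_spline_pieces n f : cardinal_spline n f ->
  exists2 Q, mspline (pred1 n) n Q & f = realize Q.
Proof.
move=> [pieces _ cont].
have [p pP] : exists p : int -> {poly R}, forall k, (size (p k) <= n.+1)%N /\
    forall x, k%:~R <= x < (k + 1)%:~R -> f x = (p k).[x].
  have ex k : exists q : {poly R}, (size q <= n.+1)%N /\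
      forall x, k%:~R <= x < (k + 1)%:~R -> f x = q.[x].
    by have [q sq fq] := pieces k; exists q.
  by have [p pP] := choice ex; exists p.
exists (fun k => p k \Po ('X + (k%:~R)%:P)); last first.
  apply/funext => x; rewrite (proj2 (pP (Num.floor x))) ?floor_cell//.
  by rewrite /realize horner_comp !hornerE subrK.
have kk (k : int) : (k%:~R : R) < (k + 1)%:~R by rewrite ltr_int; lia.
split=> [k|k j /= jn].
  by rewrite size_comp_poly2 ?size_XaddC//; case: (pP k).
have [nj|jn'] := ltnP n j.
  rewrite /jump coefB !nth_default ?subrr// (leq_trans _ nj)//.
    by rewrite !size_comp_poly2 ?size_XaddC//; case: (pP k).
  by rewrite !size_comp_poly2 ?size_XaddC//; case: (pP (k + 1)).
have ltjn : (j < n)%N by rewrite ltn_neqAle jn.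
have -> : jump (fun k => p k \Po ('X + (k%:~R)%:P)) k =
    (p (k + 1) - p k) \Po ('X + ((k + 1)%:~R)%:P).
  by rewrite /jump comp_polyB comp_poly_shift intrD.
apply: coef_shift_eq0; rewrite derivnB hornerD hornerN.
have der (l : int) : forall x, l%:~R < x < (l + 1)%:~R ->
    (f^`(j))%classic x = (p l)^`(j).[x].
  by apply: derive1n_eq_horner => x /andP[lx xl]; apply: (pP l).2; rewrite ltW.
rewrite -(continuous_eq_horner_left (kk k) (cont j ltjn) (der k)).
by rewrite -(continuous_eq_horner_right (kk _) (cont j ltjn) (der _)) subrr.
Qed.

(** The truncated power of exponent [m]; meant for positive [m], since for [m = 0]
    this is the constant 1. *)
Definition tpow (m : nat) (x : R) : R := Num.max x 0 ^+ m.

Lemma tpow_pos m x : 0 <= x -> tpow m x = x ^+ m.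
Proof. by move=> x0; rewrite /tpow max_l. Qed.

Lemma tpow_neg m x : (0 < m)%N -> x <= 0 -> tpow m x = 0.
Proof. by move=> m0 x0; rewrite /tpow max_r// expr0n gtn_eqF. Qed.

Lemma continuous_tpow m : continuous (tpow m).
Proof.
move=> x.
have mx : {for x, continuous (fun y : R => Num.max y 0)}.
  by apply: continuous_max; [exact: cvg_id|exact: cvg_cst].
apply: (@continuous_comp _ _ _ _ (fun y : R => y ^+ m) x mx).
exact: exprn_continuous.
Qed.

Lemma is_derive_tpow m (x : R) :
  is_derive x 1 (tpow m.+2) (m.+2%:R * tpow m.+1 x).
Proof.
have [x0|x0|->] := ltgtP x 0.
- apply: (@near_eq_is_derive _ _ _ (cst 0)).
    near=> y; rewrite tpow_neg// ltW//; near: y; exact: lt_nbhsl.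
  by rewrite tpow_neg ?ltW// mulr0; exact: is_derive_cst.
- apply: (@near_eq_is_derive R R^o R^o (horner 'X^(m.+2))).
    near=> y; rewrite tpow_pos ?hornerXn// ltW//; near: y; exact: lt_nbhsr.
  have := is_derive_poly ('X^(m.+2) : {poly R}) x.
  by rewrite derivXn hornerMn hornerXn /= tpow_pos ?ltW// mulr_natl.
(* At 0 the difference quotient is the truncated power of exponent [m.+1]. *)
have t0 : (fun h => h^-1 *: ((tpow m.+2 \o shift 0) (h *: 1) - tpow m.+2 0))
    @ 0^' --> (0 : R).
  have : tpow m.+1 h @[h --> 0^'] --> (0 : R).
    rewrite -[X in _ --> X](@tpow_neg m.+1 0)//.
    by apply: cvg_within_filter; exact: continuous_tpow.
  apply: cvg_trans; apply: near_eq_cvg; near=> h.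
  have h0 : h != 0 by near: h; exact: nbhs_dnbhs_neq.
  rewrite /= addr0 [h *: 1]mulr1 [tpow _ 0]tpow_neg// subr0.
  have [hneg|hpos] := leP h 0; first by rewrite !tpow_neg// scaler0.
  by rewrite !tpow_pos ?ltW// [h ^+ m.+2]exprS /GRing.scale/= mulKf.
split; first by apply/cvg_ex; exists 0.
by rewrite /derive [tpow m.+1 0]tpow_neg// mulr0; exact: cvg_lim.
Unshelve. all: by end_near. Qed.

Lemma is_derive_tpow_shift m (a x : R) :
  is_derive x 1 (fun y => tpow m.+2 (y - a)) (m.+2%:R * tpow m.+1 (x - a)).
Proof.
rewrite -[X in is_derive _ _ _ X]mulr1.
have := is_derive_tpow m (x - a); rewrite -/(shift (- a) x) => h.
exact: (is_derive1_comp h (is_derive_shift x 1 (- a))).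
Qed.

Lemma continuous_tpow_shift m (a : R) : continuous (fun y => tpow m (y - a)).
Proof.
move=> x; apply: (@continuous_comp R R R (fun y => y - a)) => //.
  by apply: continuousB; [exact: cvg_id|exact: cvg_cst].
exact: continuous_tpow.
Qed.

(** Combination of the truncated powers of exponent [n] at the knots
    0, ..., B - 1. *)
Definition tpow_sum (B n : nat) (c : nat -> R) (x : R) : R :=
  \sum_(k < B) c k * tpow n (x - k%:R).

Lemma is_derive_tpow_sum B m (c : nat -> R) (x : R) :
  is_derive x 1 (tpow_sum B m.+2 c)
    (tpow_sum B m.+1 (fun k => c k * m.+2%:R) x).
Proof.
rewrite (_ : tpow_sum B m.+2 c =
   \sum_(k < B) c k \*: (fun y => tpow m.+2 (y - k%:R) : R^o)); last first.
  by apply/funext => y; rewrite fct_sumE.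
rewrite (_ : tpow_sum B m.+1 _ x = \sum_(k < B)
    c k *: (m.+2%:R * tpow m.+1 (x - k%:R) : R^o)); last first.
  by apply: eq_bigr => k _; rewrite -mulrA.
apply: is_derive_sum => k; apply: is_deriveZ; exact: is_derive_tpow_shift.
Qed.

Lemma continuous_tpow_sum B m (c : nat -> R) : continuous (tpow_sum B m c).
Proof.
elim: B => [|B IH].
  rewrite (_ : tpow_sum 0 m c = cst 0); first exact: cst_continuous.
  by apply/funext => x; rewrite /tpow_sum big_ord0.
rewrite (_ : tpow_sum B.+1 m c = fun x => tpow_sum B m c x +
    c B * tpow m (x - B%:R)); last first.
  by apply/funext => x; rewrite /tpow_sum big_ord_recr.
move=> x; apply: continuousD; first exact: IH.
apply: continuousM; first exact: cst_continuous.
exact: continuous_tpow_shift.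
Qed.

Lemma derive1n_tpow_sum B n (c : nat -> R) j : (j < n)%N ->
  exists c', (tpow_sum B n c)^`(j)%classic = tpow_sum B (n - j) c'.
Proof.
elim: j => [_|j IH jn]; first by exists c; rewrite derive1n0 subn0.
have [c' c'E] := IH (ltnW jn).
have [m mE] : exists m, (n - j)%N = m.+2 by exists (n - j).-2; lia.
have -> : (n - j.+1)%N = m.+1 by lia.
exists (fun k => c' k * m.+2%:R); rewrite derive1nS c'E mE.
apply/funext => x; rewrite derive1E.
by have [_ ->] := is_derive_tpow_sum B m c' x.
Qed.

Lemma cardinal_spline_tpow_sum B n (c : nat -> R) : (0 < n)%N ->
  cardinal_spline n (tpow_sum B n c).
Proof.
move=> n0; split.
- move=> k; exists (\sum_(i < B | i%:Z <= k) c i *: ('X - (i%:R)%:P) ^+ n).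
    apply: leq_trans (size_sum _ _ _) _; apply/bigmax_leqP => i _.
    by rewrite (leq_trans (size_scale_leq _ _))// size_exp_XsubC.
  move=> x /andP[kx xk]; rewrite /tpow_sum horner_sum [RHS]big_mkcond /=.
  apply: eq_bigr => i _; rewrite hornerZ horner_exp !hornerE.
  case: ifPn => ik.
    rewrite tpow_pos// subr_ge0 (le_trans _ kx)//.
    by rewrite -[i%:R]/(i%:Z%:~R) ler_int.
  rewrite tpow_neg ?mulr0// subr_le0 (le_trans (ltW xk))//.
  by rewrite -[i%:R]/(i%:Z%:~R) ler_int; lia.
- move=> j jn x; have [c' ->] := derive1n_tpow_sum B c (ltnW jn).
  have [m ->] : exists m, (n - j)%N = m.+2 by exists (n - j).-2; lia.
  by have [] := is_derive_tpow_sum B m c' x.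
- move=> j jn; have [c' ->] := derive1n_tpow_sum B c jn.
  exact: continuous_tpow_sum.
Qed.
End Smooth.

(** * Multi-splines *)

Section MultiSpline.
Variable R : realType.
Local Notation mu := (@lebesgue_measure R).
Implicit Types (p q : {poly R}) (Q P : int -> {poly R}).

Variables (N : nat) (n : 'I_N.+1 -> nat).
Hypothesis n_gt0 : forall i, (0 < n i)%N.
Hypothesis n_mono : forall i j : 'I_N.+1, (i < j)%N -> (n i < n j)%N.

(** The set of values of [n]. *)
Definition degrees : pred nat := fun j => [exists s, n s == j].

Let n_inj : injective n.
Proof.
move=> i j nij; apply/val_inj/eqP => /=.
by case: ltngtP => // /n_mono; rewrite nij ltnn.
Qed.

Lemma degree_le i : (n i <= n ord_max)%N.
Proof.
have [->//|im] := eqVneq i ord_max; apply/ltnW/n_mono.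
by rewrite ltn_neqAle -ltnS ltn_ord andbT -val_eqE in im *.
Qed.

Lemma count_degrees : count degrees (iota 0 (n ord_max).+1) = N.+1.
Proof.
rewrite -size_filter -[RHS]card_ord -(size_codom n).
apply/perm_size/uniq_perm.
- exact: filter_uniq (iota_uniq _ _).
- exact/injectiveP.
move=> j; rewrite mem_filter mem_iota /= add0n ltnS.
apply/andP/codomP => [[/existsP[s /eqP <-] _]|[s ->]]; first by exists s.
by rewrite degree_le; split=> //; apply/existsP; exists s.
Qed.

Lemma sparse_poly p : (forall j, ~~ degrees j -> p`_j = 0) ->
  p = \sum_s p`_(n s) *: 'X^(n s).
Proof.
move=> p0; apply/polyP => j; rewrite coef_sum.
have [/existsP[s /eqP <-]|dj] := boolP (degrees j).
  rewrite (bigD1 s)//= coefZ coefXn eqxx mulr1 big1 ?addr0// => t ts.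
  by rewrite coefZ coefXn (inj_eq n_inj) eq_sym (negbTE ts) mulr0.
rewrite p0// big1// => s _; rewrite coefZ coefXn.
have [jn|_] := eqVneq j (n s); last by rewrite mulr0.
by case/existsP: dj; exists s; rewrite jn.
Qed.

(** Telescoping of the jumps at the integers 0, ..., k. *)
Lemma pieces_of_jumps P (k : nat) : P (-1) = 0 ->
  P k = \sum_(i < k.+1) (jump P (i%:Z - 1) \Po ('X + (k%:R - i%:R)%:P)).
Proof.
move=> P0; elim: k => [|k IH].
  by rewrite big_ord1 subrr addr0 comp_polyXr /jump sub0r P0 comp_poly0 subr0.
rewrite big_ord_recr /= subrr addr0 comp_polyXr.
have -> : k.+1%:Z - 1 = k by lia.
have k1 : k%:Z + 1 = k.+1 by lia.
rewrite {2}/jump k1 IH raddf_sum /=.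
rewrite [X in _ + (_ - X)](_ : _ = \sum_(i < k.+1)
  (jump P (i%:Z - 1) \Po ('X + (k.+1%:R - i%:R)%:P))).
  by rewrite addrC subrK.
by apply: eq_bigr => i _; rewrite comp_poly_shift -natr1 addrAC.
Qed.

(** Terms beyond [B] are void, either because the coefficient is 0 or because the
    knot lies to the right of [x]. *)
Lemma tpow_sum_widen B B' m (c : nat -> R) x : (0 < m)%N -> (B <= B')%N ->
  (forall i, (B <= i)%N -> c i = 0 \/ x <= i%:R) ->
  tpow_sum B' m c x = tpow_sum B m c x.
Proof.
move=> m0 BB' c0; rewrite /tpow_sum.
rewrite [RHS](big_ord_widen B' (fun k => c k * tpow m (x - k%:R)) BB').
rewrite [RHS]big_mkcond; apply: eq_bigr => i _; case: ltnP => // /c0[->|xi].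
  by rewrite mul0r.
by rewrite tpow_neg ?subr_le0// mulr0.
Qed.

(** A compactly supported element is the sum of the truncated powers carried by
    its finitely many jumps. *)
Lemma multi_spline_realize M d P : supported M P -> mspline degrees d P ->
  multi_spline n (realize P).
Proof.
move=> sP [_ jP]; pose c s (i : nat) := (jump P (i%:Z - 1))`_(n s).
exists (fun s => tpow_sum M.+1 (n s) (c s)) => [s|x].
  exact: cardinal_spline_tpow_sum.
(* The last jump is at the integer [M], where the support ends. *)
have cM s i : (M.+1 <= i)%N -> c s i = 0.
  move=> Mi; rewrite /c /jump !sP ?comp_poly0 ?subr0 ?coef0//; lia.
have /andP[kx xk] := floor_cell x; rewrite /realize.
case: (Num.floor x) kx xk => k kx xk; last first.
  have x0 : x <= 0 by rewrite (le_trans (ltW xk))// (ler_int R _ 0); lia.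
  rewrite sP// horner0 big1// => s _.
  rewrite (@tpow_sum_widen 0) ?n_gt0//; first by rewrite /tpow_sum big_ord0.
  by move=> i _; right; rewrite (le_trans x0).
rewrite intrD -[k%:~R]/(k%:R : R) natr1 in kx xk *.
rewrite (pieces_of_jumps _ (supported_lt0 sP _))// horner_sum.
transitivity (\sum_s tpow_sum k.+1 (n s) (c s) x).
  rewrite exchange_big; apply: eq_bigr => i _.
  rewrite {1}(sparse_poly (jP _)) horner_comp horner_sum.
  apply: eq_bigr => s _; rewrite hornerZ hornerXn !hornerE tpow_pos.
    by congr (_ * _ ^+ _); rewrite /= subrK.
  rewrite subr_ge0 (le_trans _ kx)// ler_nat -ltnS; exact: ltn_ord.
apply: eq_bigr => s _; pose B := maxn M.+1 k.+1.
rewrite -(@tpow_sum_widen k.+1 B) ?n_gt0 ?leq_maxr//; last first.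
  by move=> i ki; right; rewrite (le_trans (ltW xk))// ler_nat.
by apply: tpow_sum_widen; rewrite ?n_gt0 ?leq_maxl// => i Mi; left; exact: cM.
Qed.

Lemma generates_realize d K (P : 'I_K -> int -> {poly R}) L :
  d = n ord_max -> mBpieces degrees d P L ->
  generates n (fun i => realize (P i)).
Proof.
move=> dn h f [g gS fE].
have exQ s : exists Q, mspline (pred1 (n s)) (n s) Q /\ g s = realize Q.
  by have [Q mQ gQ] := cardinal_spline_pieces (gS s); exists Q.
have [Q QP] := choice exQ.
have mQ : mspline degrees d (fun k => \sum_s Q s k).
  apply: mspline_sum => s; have [[sz jp] _] := QP s; split=> [k|k j Dj].
    by rewrite (leq_trans (sz k))// dn ltnS degree_le.
  apply: jp; apply: contra Dj => /eqP ->; apply/existsP; exists s.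
  exact: eqxx.
have [c cE] := mBp_gen h mQ; exists c => x.
pose k := Num.floor x; pose z := x - k%:~R.
have termE i (l : int) : realize (P i) (x - l%:~R) = (P i (k - l)).[z].
  by rewrite realize_translate.
(* Only the shifts whose support contains the cell of [x] contribute. *)
pose r := [seq k - j%:Z | j <- iota 0 d.+1].
rewrite (@fsbigE _ _ _ _ _ r); last 3 first.
- by rewrite map_inj_uniq ?iota_uniq// => i j /addrI/oppr_inj[].
- by [].
- move=> l _ lr; rewrite big1// => i _; rewrite termE.
  rewrite (supportedW (mBp_supp h i) (mBp_le i h)) ?horner0 ?mulr0//.
  apply: contra lr => kl; apply/mapP; exists `|k - l|%N; last by lia.
  by rewrite mem_iota; lia.
rewrite (eq_bigl predT) => [|l]; last by rewrite in_setT.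
rewrite big_map -/(index_iota 0 d.+1) big_mkord exchange_big /=.
have -> : f x = \sum_s (Q s k).[z].
  by rewrite fE; apply: eq_bigr => s _; rewrite (QP s).2.
rewrite -horner_sum cE horner_sum; apply: eq_bigr => i _.
rewrite /conv horner_sum; apply: eq_bigr => j _.
by rewrite hornerZ termE; congr (_ * (P i _).[_]); ring.
Qed.

End MultiSpline.

Theorem theorem3 (R : realType) (N : nat) (n : 'I_N.+1 -> nat)
    (hpos : forall i, (0 < n i)%N)
    (hincr : forall i j : 'I_N.+1, (i < j)%N -> (n i < n j)%N) :
  exists eta : 'I_N.+1 -> R -> R,
    [/\ forall i, eta i \in Lfun (@lebesgue_measure R) 2%:E,
        mB_spline n eta
      & constructible eta].
Proof.
have Dd : degrees n (n ord_max) by apply/existsP; exists ord_max.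
have := constructible_pieces R Dd; rewrite count_degrees//.
move=> [P [L [h cP]]]; exists (fun i => realize (P i)); split=> //.
  by move=> i; apply: Lfun2_realize (mBp_supp h i).
have P0 i j : (j < L i)%N -> P i j%:Z != 0 := mBpieces_neq0 h.
split.
- move=> i; rewrite /compactly_supported.
  rewrite (supp_realize (mBp_supp h i) (P0 i) (mBp_pos h i)).
  exact: segment_compact.
- by move=> i; apply: multi_spline_realize (mBp_supp h i) (mBp_spline h i).
- exact: generates_realize h.
under eq_bigr do rewrite (supp_size_realize (mBp_supp h _) (P0 _) (mBp_pos h _)).
by rewrite sumEFin -natr_sum (mBp_size h).
Qed.
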